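(* Let $s>0$ and $n\in\mathbb N$, $n\ge1$, be fixed and let $q\in H^s(\mathbb T)$ be real-valued. Assume $\|q\|_s\le\frac{n}{2C_s}$, with $C_s$ the constant of the context. Let $f_{n,\pm}$ be the eigenfunctions of $-\partial_{xx}+q(x)$ associated with the eigenvalues $\lambda_{n,\pm}$, as described in the context. Then, for any $m\in\mathbb Z$, $$\big|(f_{n,\pm},e_m)_{L^2}\big|\le 2\,\langle |m|-n\rangle^{-s}.$$
   Context: $\mathbb T=\mathbb R/2\pi\mathbb Z$, $e_j(x):=e^{\mathrm ijx}$, $\langle k\rangle:=\max\{1,|k|\}$. The $L^2(\mathbb T)$ product is normalized so that $(e_j)_{j\in\mathbb Z}$ is orthonormal, $\hat u(j)=(u,e_j)_{L^2}$, $\|u\|_s^2=\sum_j\langle j\rangle^{2s}|\hat u(j)|^2$, and for $j\in\mathbb Z$ the shifted norm is $\|u\|_{s;j}:=\|ue_j\|_s$. Fix $n\ge1$. $\mathcal P_n:=\operatorname{span}_{\mathbb C}\{e_n,e_{-n}\}$, $\mathcal Q_n:=\{v\in H^s(\mathbb T):\hat v(m)=0\text{ for }|m|=n\}$, with orthogonal projections $P_n,Q_n$. Let $\mathcal U_n:=\{\mu\in\mathbb C:|\mu-n^2|\le n/2\}$. For $\lambda\in\mathcal U_n$ let $A_\lambda:=\partial_{xx}+\lambda$ (invertible on the range of $Q_n$), $Vf:=qf$, $T_n:=A_\lambda^{-1}Q_nV$. $C_s>0$ is a constant depending only on $s$ (in particular independent of $n$) such that $\|T_nw\|_{s;j}\le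 C_s\,n^{-1}\|q\|_s\|w\|_{s;j}$ for all $w\in H^s(\mathbb T)$, $j\in\mathbb Z$, $\lambda\in\mathcal U_n$. When $\|q\|_s\le n/(2C_s)$, $\mathrm{Id}-T_n$ is invertible. Set $$a_n:=(V(\mathrm{Id}-T_n)^{-1}e_n,e_n)_{L^2},\quad a_{-n}:=(V(\mathrm{Id}-T_n)^{-1}e_{-n},e_{-n})_{L^2},$$ $$c_n:=(V(\mathrm{Id}-T_n)^{-1}e_{-n},e_n)_{L^2},\quad c_{-n}:=(V(\mathrm{Id}-T_n)^{-1}e_n,e_{-n})_{L^2},$$ $$S_n(\lambda):=\begin{pmatrix}\lambda-n^2-a_{-n}&-c_{-n}\\-c_n&\lambda-n^2-a_n\end{pmatrix}.$$ The eigenvalue equation $-f''+qf=\lambda f$, written for $f=u+v$ with $u=P_nf$, $v=Q_nf$, is equivalent for $\lambda\in\mathcal U_n$ to $v=(\mathrm{Id}-T_n)^{-1}T_nu$ and $S_n(\lambda)(\hat u(-n),\hat u(n))^T=0$. $\lambda_{n,\pm}$ are the two roots of $\det S_n(\lambda)$ in $D_n:=\{\mu\in\mathbb C:|\mu-n^2|\le\tfrac{2C_s}{3}\|q\|_s\}\subset\mathcal U_n$; $u_{n,\pm}=\hat u_{n,\pm}(-n)e_{-n}+\hat u_{n,\pm}(n)e_n$ is a corresponding nonzero solution of $S_n(\lambda_{n,\pm})u_{n,\pm}=0$, normalized so that $|\hat u_{n,\pm}(\pm n)|\le1$ for both coefficients; and $f_{n,\pm}:=u_{n,\pm}+(\mathrm{Id}-T_n)^{-1}T_nu_{n,\pm}$,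 with $T_n$ evaluated at $\lambda=\lambda_{n,\pm}$. *)

(* Defs.v *)
From mathcomp Require Import all_boot all_order all_algebra.
From mathcomp Require Import complex.
From mathcomp Require Import all_classical all_reals all_analysis.

Set Implicit Arguments.
Unset Strict Implicit.
Unset Printing Implicit Defensive.

Import Order.TTheory GRing.Theory Num.Theory.
Import numFieldNormedType.Exports.

Local Open Scope classical_set_scope.
Local Open Scope ring_scope.
Local Open Scope complex_scope.

(* Functions on T = R / 2 pi Z are 2 pi-periodic functions R -> R[i]; elements
   of L^2 and H^s are represented by such functions, and equality of elements
   is equality almost everywhere.  The real-valued modulus is [cmod], the norm
   `|z| of R[i] being itself an element of R[i]. *)

Definition cmod (R : realType) (z : R[i]) : R := complex.Re `|z|.

Definition bracket (R : realType) (k : int) : R := Num.max 1 `|k%:~R|.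

Definition cexp (R : realType) (j : int) (x : R) : R[i] :=
  cos (j%:~R * x) +i* sin (j%:~R * x).

Definition in_L2 (R : realType) (u : R -> R[i]) : Prop :=
  [/\ forall x, u (x + 2 * pi) = u x,
      measurable_fun setT (fun x => complex.Re (u x)),
      measurable_fun setT (fun x => complex.Im (u x)) &
      lebesgue_measure.-integrable `[0, 2 * pi]
        (fun x => (cmod (u x) ^+ 2)%:E)].

Definition cintegral (R : realType) (u : R -> R[i]) : R[i] :=
  Rintegral lebesgue_measure `[0, 2 * pi] (fun x => complex.Re (u x)) +i*
  Rintegral lebesgue_measure `[0, 2 * pi] (fun x => complex.Im (u x)).

(* Also used when [u] is a product of two L^2 functions and [v] is bounded. *)
Definition inner (R : realType) (u v : R -> R[i]) : R[i] :=
  ((2 * pi)^-1)%:C * cintegral (fun x => u x * (v x)^*).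

Definition fourier (R : realType) (u : R -> R[i]) (j : int) : R[i] :=
  inner u (cexp j).

(* Extended-real valued: +oo outside H^s. *)
Definition snorm (R : realType) (s : R) (u : R -> R[i]) : \bar R :=
  poweR (\esum_(j in [set: int])
           (bracket R j `^ (2 * s) * cmod (fourier u j) ^+ 2)%:E) 2^-1.

Definition in_Hs (R : realType) (s : R) (u : R -> R[i]) : Prop :=
  in_L2 u /\ (snorm s u < +oo)%E.

Definition shifted_snorm (R : realType) (s : R) (j : int) (u : R -> R[i])
    : \bar R :=
  snorm s (fun x => u x * cexp j x).

Definition real_valued (R : realType) (u : R -> R[i]) : Prop :=
  {ae lebesgue_measure, forall x : R, complex.Im (u x) = 0}.

(* The sum over Z, as the limit of the symmetric partial sums. *)
Definition zsum (R : realType) (c : int -> R[i]) : R[i] :=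
  let S N := \sum_(k < (N.*2).+1) c (k%:Z - N%:Z) in
  limn (fun N => complex.Re (S N)) +i* limn (fun N => complex.Im (S N)).

Definition Pn (R : realType) (n : nat) (u : R -> R[i]) : R -> R[i] :=
  fun x => fourier u n%:Z * cexp n%:Z x + fourier u (- n%:Z) * cexp (- n%:Z) x.

Definition Qn (R : realType) (n : nat) (u : R -> R[i]) : R -> R[i] :=
  fun x => u x - Pn n u x.

Definition in_Un (R : realType) (n : nat) (lam : R[i]) : Prop :=
  cmod (lam - n%:R ^+ 2) <= n%:R / 2.

(* The inverse of A_lam = d^2/dx^2 + lam, which multiplies e_m by lam - m^2.
   It is only applied to the range of Q_n with lam in U_n, where the modes with
   |m| = n, the only ones for which lam - m^2 may vanish, are absent. *)
Definition Ainv (R : realType) (lam : R[i]) (g : R -> R[i]) : R -> R[i] :=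
  fun x => zsum (fun m => (lam - m%:~R ^+ 2)^-1 * fourier g m * cexp m x).

Definition V (R : realType) (q f : R -> R[i]) : R -> R[i] :=
  fun x => q x * f x.

Definition Tn (R : realType) (q : R -> R[i]) (n : nat) (lam : R[i])
    (w : R -> R[i]) : R -> R[i] :=
  Ainv lam (Qn n (V q w)).

(* [C] is admissible as the constant C_s: it depends on s only, being uniform
   in n, q, lam, j and w. *)
Definition Tn_bound (R : realType) (s C : R) : Prop :=
  forall (n : nat) (q : R -> R[i]), (1 <= n)%N -> in_Hs s q -> real_valued q ->
  forall (lam : R[i]) (j : int) (w : R -> R[i]), in_Un n lam -> in_Hs s w ->
  (shifted_snorm s j (Tn q n lam w) <=
     (C / n%:R)%:E * snorm s q * shifted_snorm s j w)%E.

(* (Id - T_n)^{-1} on H^s: the solution w in H^s, unique up to a null set, of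
   w - T_n w = g. *)
Definition resolvent (R : realType) (s : R) (q : R -> R[i]) (n : nat)
    (lam : R[i]) (g : R -> R[i]) : R -> R[i] :=
  xget (fun=> 0)
    [set w : R -> R[i] | in_Hs s w /\
       {ae lebesgue_measure, forall x : R, w x - Tn q n lam w x = g x}].

(* The paper's coefficients a_{n}, a_{-n}, c_{n}, c_{-n} are obtained with
   k = n and k = - n. *)
Definition a_coef (R : realType) (s : R) (q : R -> R[i]) (n : nat)
    (lam : R[i]) (k : int) : R[i] :=
  inner (V q (resolvent s q n lam (cexp k))) (cexp k).

Definition c_coef (R : realType) (s : R) (q : R -> R[i]) (n : nat)
    (lam : R[i]) (k : int) : R[i] :=
  inner (V q (resolvent s q n lam (cexp (- k)))) (cexp k).

Definition Sn (R : realType) (s : R) (q : R -> R[i]) (n : nat) (lam : R[i])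
    : 'M[R[i]]_2 :=
  let a := a_coef s q n lam in let c := c_coef s q n lam in
  \matrix_(i, j)
    if i == 0 then
      if j == 0 then lam - n%:R ^+ 2 - a (- n%:Z) else - c (- n%:Z)
    else
      if j == 0 then - c n%:Z else lam - n%:R ^+ 2 - a n%:Z.

Definition in_Dn (R : realType) (s C : R) (q : R -> R[i]) (n : nat)
    (lam : R[i]) : Prop :=
  ((cmod (lam - n%:R ^+ 2))%:E <= (2 * C / 3)%:E * snorm s q)%E.

(* [U] holds the coefficients of u, in the order (u^(-n), u^(n)). *)
Definition u_fun (R : realType) (n : nat) (U : 'cV[R[i]]_2) : R -> R[i] :=
  fun x => U 0 0 * cexp (- n%:Z) x + U 1 0 * cexp n%:Z x.

Definition f_fun (R : realType) (s : R) (q : R -> R[i]) (n : nat) (lam : R[i])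
    (U : 'cV[R[i]]_2) : R -> R[i] :=
  let u := u_fun n U in
  fun x => u x + resolvent s q n lam (Tn q n lam u) x.

(* Main.v *)
Require Import Defs.
From mathcomp Require Import all_boot all_order all_algebra.
From mathcomp Require Import complex.
From mathcomp Require Import all_classical all_reals all_analysis.
From mathcomp Require Import measurable_realfun.
From mathcomp Require Import zify ring lra.

Set Implicit Arguments.
Unset Strict Implicit.
Unset Printing Implicit Defensive.

Import Order.TTheory GRing.Theory Num.Theory.
Import numFieldNormedType.Exports.

Local Open Scope classical_set_scope.
Local Open Scope ring_scope.
Local Open Scope complex_scope.

(** Write [T] for [Tn q n lam] and [u] for [u_fun n U], and let [w] be the
    resolvent part of [f_fun], so that [f = u + w] and [w = T w + T u] almost
    everywhere.  Substituting this equation into itself gives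
      [w = T u + T^2 u + ... + T^N u + T^N w]     (see [unroll_resolvent]).
    Since [q] is small, [T] halves every shifted norm ([Tn_contraction]).  The
    norm shifted by [- j] gives [e_j] the size [1] and weighs the mode [m] by
    [<m - j>^s], hence
      [|(T^k e_j)^(m)| <= 2^-k <m - j>^(-s)]     (see [iter_mode_coef_le]).
    Now [u] is a combination of [e_n] and [e_(-n)] with coefficients of modulus
    at most [1], and [|m - n|] and [|m + n|] are both at least [||m| - n|].
    Summing over [k >= 1], each of the two modes contributes at most
    [<|m| - n>^(-s)] to the coefficient of [w], while [T^N w] tends to [0]; this
    is [resolvent_coef_le].  The sum starts at [k = 1], which is where the
    constant [2], rather than [4], comes from.  The term [k = 0] is [u] itself,
    which lives on the modes [|m| = n]; there [T] has no coefficient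
    ([fourier_Tn_resonant]), so the coefficient of [f] is that of [u], of
    modulus at most [1].

    This computation needs [T] to be linear, to ignore null sets and to have the
    expected Fourier coefficients.  All three rest on absolute convergence: the
    symbol [1 / (lam - m^2)] is [O(m^-2)] ([symbol_decay]), and the coefficients
    of [q w] are bounded because a product of L^2 functions is integrable.  So
    the series defining [T w] converges absolutely with uniformly bounded
    partial sums, its sum is a bounded measurable periodic function, and
    integration term by term gives its coefficients ([fourier_fseries]).

    If no [w] in [H^s] solves the equation, the resolvent is [0] by convention
    and [f = u], for which the estimate is immediate. *)

(** * Moduli, characters and brackets *)

Section Modulus.
Context {R : realType}.
Implicit Types z w : R[i].

Lemma cmodE z : cmod z = Num.sqrt (complex.Re z ^+ 2 + complex.Im z ^+ 2).
Proof. by rewrite /cmod normc_def. Qed.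

Lemma sqr_cmod z : cmod z ^+ 2 = complex.Re z ^+ 2 + complex.Im z ^+ 2.
Proof. by rewrite cmodE sqr_sqrtr ?addr_ge0 ?sqr_ge0. Qed.

Lemma cmod_ge0 z : 0 <= cmod z.
Proof. by rewrite cmodE sqrtr_ge0. Qed.

Lemma cmodM z w : cmod (z * w) = cmod z * cmod w.
Proof. by rewrite /cmod normrM !normc_def /= !mulr0 subr0. Qed.

Lemma ler_cmodD z w : cmod (z + w) <= cmod z + cmod w.
Proof.
have := ler_normD z w; rewrite lecE => /andP[_].
by rewrite /cmod !normc_def.
Qed.

Lemma cmod0 : cmod (0 : R[i]) = 0.
Proof. by rewrite /cmod normr0. Qed.

Lemma cmod1 : cmod (1 : R[i]) = 1.
Proof. by rewrite /cmod normr1. Qed.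

Lemma cmodC z : cmod z^*%R = cmod z.
Proof. by rewrite !cmodE; case: z => a b /=; rewrite sqrrN. Qed.

Lemma cmodB z w : cmod (z - w) = cmod (w - z).
Proof. by rewrite /cmod distrC. Qed.

Lemma cmodV z : cmod z^-1 = (cmod z)^-1.
Proof.
have [->|z0] := eqVneq z 0; first by rewrite invr0 cmod0 invr0.
have zV : cmod z^-1 * cmod z = 1 by rewrite -cmodM mulVf // cmod1.
have cz : cmod z != 0.
  apply/eqP => cz; move: zV; rewrite cz mulr0 => /eqP.
  by rewrite eq_sym oner_eq0.
by apply: (mulIf cz); rewrite zV mulVf.
Qed.

Lemma cmod_real (a : R) : cmod a%:C = `|a|.
Proof. by rewrite cmodE /= expr0n addr0 sqrtr_sqr. Qed.

Lemma norm_Re_le z : `|complex.Re z| <= cmod z.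
Proof.
rewrite cmodE -sqrtr_sqr ler_wsqrtr // lerDl sqr_ge0 //.
Qed.

Lemma norm_Im_le z : `|complex.Im z| <= cmod z.
Proof.
rewrite cmodE -sqrtr_sqr ler_wsqrtr // lerDr sqr_ge0 //.
Qed.

Lemma cReD z w : complex.Re (z + w) = complex.Re z + complex.Re w.
Proof. by case: z w => [a b] [c d]. Qed.

Lemma cImD z w : complex.Im (z + w) = complex.Im z + complex.Im w.
Proof. by case: z w => [a b] [c d]. Qed.

Lemma cReM z w : complex.Re (z * w) =
  complex.Re z * complex.Re w - complex.Im z * complex.Im w.
Proof. by case: z w => [a b] [c d]. Qed.

Lemma cImM z w : complex.Im (z * w) =
  complex.Re z * complex.Im w + complex.Im z * complex.Re w.
Proof. by case: z w => [a b] [c d] /=. Qed.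

Lemma eq_ReIm z w :
  complex.Re z = complex.Re w -> complex.Im z = complex.Im w -> z = w.
Proof. by case: z w => [a b] [c d] /= -> ->. Qed.

Lemma cmod_le_ReIm z : cmod z <= `|complex.Re z| + `|complex.Im z|.
Proof.
have nn : 0 <= `|complex.Re z| + `|complex.Im z| by apply: addr_ge0.
rewrite -(ler_pXn2r (n := 2)) ?nnegrE ?cmod_ge0 // sqr_cmod.
rewrite -(real_normK (num_real (complex.Re z))).
rewrite -(real_normK (num_real (complex.Im z))).
rewrite sqrrD lerD2r lerDl mulrn_wge0 //; exact: mulr_ge0.
Qed.

End Modulus.

Section Characters.
Context {R : realType}.
Implicit Types (j k : int) (x : R).

Lemma cexp0 x : cexp 0 x = 1.
Proof. by rewrite /cexp mul0r cos0 sin0. Qed.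

Lemma cexpD j k x : cexp (j + k) x = cexp j x * cexp k x.
Proof.
apply: eq_ReIm; rewrite ?cReM ?cImM /= rmorphD /= mulrDl ?cosD ?sinD //; ring.
Qed.

Lemma cexpN j x : cexp (- j) x = (cexp j x)^*%R.
Proof. by rewrite /cexp /= rmorphN /= mulNr cosN sinN. Qed.

Lemma cmod_cexp j x : cmod (cexp j x) = 1.
Proof. by rewrite cmodE /= cos2Dsin2 sqrtr1. Qed.

Lemma cexp_periodic j x : cexp j (x + 2 * pi) = cexp j x.
Proof.
have base (n : nat) y : cexp n%:Z (y + 2 * pi) = cexp n%:Z y :> R[i].
  rewrite /cexp mulrDr.
  have -> : (n%:Z)%:~R * (2 * pi) = (pi *+ 2) *+ n :> R.
    by rewrite -pmulrn -[in RHS]mulr_natl -(mulr_natl pi).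
  by rewrite (periodicn (@cosD2pi R)) (periodicn (@sinD2pi R)).
case: (intP j) => [|n|n]; rewrite ?cexp0 ?base //.
by rewrite !cexpN base.
Qed.

End Characters.

Section Bracket.
Context {R : realType}.
Implicit Types (s : R) (j k : int).

Lemma bracket_ge1 k : 1 <= bracket R k.
Proof. by rewrite /bracket le_max lexx. Qed.

Lemma bracket_gt0 k : 0 < bracket R k.
Proof. exact: lt_le_trans (bracket_ge1 k). Qed.

Lemma bracketS (N : nat) : bracket R N.+1%:Z = N.+1%:R.
Proof.
by rewrite /bracket -pmulrn ger0_norm ?ler0n // max_r // ler1n.
Qed.

Lemma bracketN k : bracket R (- k) = bracket R k.
Proof. by rewrite /bracket rmorphN normrN. Qed.

Lemma bracket0 : bracket R 0 = 1.
Proof. by rewrite /bracket rmorph0 normr0 max_l. Qed.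

Lemma le_bracket j k : (`|j| <= `|k|)%N -> bracket R j <= bracket R k.
Proof.
move=> jk; rewrite /bracket -!intr_norm -!abszE.
by rewrite ge_max !le_max lexx /= -!pmulrn ler_nat jk orbT.
Qed.

Lemma ler_bracket_powRN s j k : 0 <= s -> (`|j| <= `|k|)%N ->
  bracket R k `^ (- s) <= bracket R j `^ (- s).
Proof.
move=> s0 jk; rewrite !powRN lef_pV2 ?posrE ?powR_gt0 ?bracket_gt0 //.
apply: ge0_ler_powR => //; rewrite ?nnegrE ?(ltW (bracket_gt0 _)) //.
exact: le_bracket.
Qed.

End Bracket.

(** * Integration over a period *)

Section Integrability.
Context {R : realType}.
Implicit Types (u v : R -> R[i]) (a : R[i]).

Local Notation mu := (@lebesgue_measure R).
Local Notation I := (`[0, 2 * pi]%classic : set R).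

Definition cmeasurable u : Prop :=
  measurable_fun setT (fun x => complex.Re (u x)) /\
  measurable_fun setT (fun x => complex.Im (u x)).

Definition cintegrable u : Prop :=
  mu.-integrable I (EFin \o (fun x => complex.Re (u x))) /\
  mu.-integrable I (EFin \o (fun x => complex.Im (u x))).

(** Lebesgue measure lives on the sigma-algebra of [measurableTypeR R]; the
    ascription lets this fact unify with the integrals against it. *)
Lemma period_measurable : measurable (I : set (measurableTypeR R)).
Proof. exact: measurable_itv. Qed.

Lemma pi2_gt0 : 0 < 2 * pi :> R.
Proof. by rewrite mulr_gt0 // pi_gt0. Qed.

Lemma period_mass : mu I = (2 * pi)%:E.
Proof.
by rewrite lebesgue_measure_itv /= lte_fin pi2_gt0 -EFinB subr0.
Qed.

Lemma cmeasurable_cst a : cmeasurable (fun=> a).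
Proof. by split; exact: measurable_cst. Qed.

Lemma cmeasurableD u v :
  cmeasurable u -> cmeasurable v -> cmeasurable (fun x => u x + v x).
Proof.
move=> [u1 u2] [v1 v2]; split.
  by under eq_fun do rewrite cReD; exact: measurable_funD.
by under eq_fun do rewrite cImD; exact: measurable_funD.
Qed.

Lemma cmeasurableM u v :
  cmeasurable u -> cmeasurable v -> cmeasurable (fun x => u x * v x).
Proof.
move=> [u1 u2] [v1 v2]; split.
  under eq_fun do rewrite cReM.
  by apply: measurable_funB; exact: measurable_funM.
under eq_fun do rewrite cImM.
by apply: measurable_funD; exact: measurable_funM.
Qed.

Lemma cmeasurable_cexp j : cmeasurable (cexp j).
Proof.
split => /=; apply: continuous_measurable_fun => x; apply: continuous_comp;
  rewrite ?/continuous_at; first [exact: mulrl_continuous |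
    exact: continuous_cos | exact: continuous_sin].
Qed.

Lemma cmeasurable_sqr_cmod u : cmeasurable u ->
  measurable_fun setT (fun x => cmod (u x) ^+ 2).
Proof.
move=> [u1 u2]; under eq_fun do rewrite sqr_cmod.
by apply: measurable_funD; exact: measurable_funX.
Qed.

Lemma cintegrable_dominated u (g : R -> R) : cmeasurable u ->
    mu.-integrable I (EFin \o g) -> (forall x, cmod (u x) <= g x) ->
  cintegrable u.
Proof.
move=> [u1 u2] ig ug; split; apply: (le_integrable period_measurable _ _ ig).
- apply/measurable_EFinP; exact: measurable_funTS.
- move=> x _ /=; rewrite lee_fin (le_trans (norm_Re_le _)) //.
  by rewrite (le_trans (ug x)) // ler_norm.
- apply/measurable_EFinP; exact: measurable_funTS.
- move=> x _ /=; rewrite lee_fin (le_trans (norm_Im_le _)) //.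
  by rewrite (le_trans (ug x)) // ler_norm.
Qed.

Lemma bounded_period (h : R -> R) (K : R) :
  (forall x, `|h x| <= K) -> [bounded h x | x in I].
Proof.
move=> hK; exists K; split; first exact: num_real.
by move=> M KM x _ /=; rewrite (le_trans (hK x)) // ltW.
Qed.

Lemma integrable_period_cst (K : R) : mu.-integrable I (EFin \o cst K).
Proof.
apply: (measurable_bounded_integrable period_measurable).
- exact: (eq_ind_r (fun m => (m < +oo)%E) (ltry _) period_mass).
- exact: measurable_cst.
- exact: (bounded_period (K := `|K|)).
Qed.

Lemma in_L2_bounded u (K : R) : (forall x, u (x + 2 * pi) = u x) ->
  cmeasurable u -> (forall x, cmod (u x) <= K) -> in_L2 u.
Proof.
move=> up um uK; case: (um) => u1 u2; split => //.
apply: (le_integrable period_measurable _ _ (integrable_period_cst (K ^+ 2))).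
  apply/measurable_EFinP; apply: measurable_funTS.
  exact: cmeasurable_sqr_cmod.
move=> x _ /=; rewrite lee_fin !ger0_norm ?sqr_ge0 //.
by rewrite lerXn2r ?nnegrE ?cmod_ge0 // (le_trans (cmod_ge0 (u x))).
Qed.

Lemma in_L2_cexp j : in_L2 (@cexp R j).
Proof.
apply: (@in_L2_bounded _ 1); first exact: cexp_periodic.
  exact: cmeasurable_cexp.
by move=> x; rewrite cmod_cexp.
Qed.

(** Two L^2 functions have an integrable product, as
    [|u v| <= |u|^2 + |v|^2]; this makes the Fourier coefficients of [q w]
    meaningful although [q w] need not be square integrable. *)
Lemma cintegrableM u v : in_L2 u -> in_L2 v -> cintegrable (fun x => u x * v x).
Proof.
move=> [_ u1 u2 iu] [_ v1 v2 iv].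
pose g x : R := cmod (u x) ^+ 2 + cmod (v x) ^+ 2.
apply: (@cintegrable_dominated _ g); first exact: cmeasurableM.
  exact: (integrableD period_measurable iu iv).
move=> x; rewrite cmodM /g.
have := cmod_ge0 (u x); have := cmod_ge0 (v x).
by move: (cmod (u x)) (cmod (v x)) => a b; nra.
Qed.

Lemma in_L2_cintegrable u : in_L2 u -> cintegrable u.
Proof.
move=> uL; have := cintegrableM uL (in_L2_cexp 0).
by under eq_fun do rewrite cexp0 mulr1.
Qed.

Lemma cintegrable_bdd u v (K : R) : cintegrable u -> cmeasurable v ->
  (forall x, cmod (v x) <= K) -> cintegrable (fun x => u x * v x).
Proof.
move=> [u1 u2] [v1 v2] vK.
have vR : [bounded complex.Re (v x) | x in I].
  by apply: (bounded_period (K := K)) => x; rewrite (le_trans (norm_Re_le _)).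
have vI : [bounded complex.Im (v x) | x in I].
  by apply: (bounded_period (K := K)) => x; rewrite (le_trans (norm_Im_le _)).
have M f h :=
  integrableMl period_measurable (mu := mu) (f := EFin \o f) (h := h).
split.
  under [X in EFin \o X]eq_fun do rewrite cReM.
  have i1 := M _ _ u1 (measurable_funTS v1) vR.
  have i2 := M _ _ u2 (measurable_funTS v2) vI.
  exact: (integrableB period_measurable i1 i2).
under [X in EFin \o X]eq_fun do rewrite cImM.
have i1 := M _ _ u1 (measurable_funTS v2) vI.
have i2 := M _ _ u2 (measurable_funTS v1) vR.
exact: (integrableD period_measurable i1 i2).
Qed.

Lemma cintegrableD u v : cintegrable u -> cintegrable v ->
  cintegrable (fun x => u x + v x).
Proof.
move=> [u1 u2] [v1 v2]; split.
  under [X in EFin \o X]eq_fun do rewrite cReD.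
  exact: (integrableD period_measurable u1 v1).
under [X in EFin \o X]eq_fun do rewrite cImD.
exact: (integrableD period_measurable u2 v2).
Qed.

Lemma cintegrableZ a u : cintegrable u -> cintegrable (fun x => a * u x).
Proof.
move=> iu; under eq_fun do rewrite mulrC.
by apply: (cintegrable_bdd (K := cmod a)) => //; exact: cmeasurable_cst.
Qed.

Lemma cintegrable_cexp j : cintegrable (@cexp R j).
Proof. exact/in_L2_cintegrable/in_L2_cexp. Qed.

Lemma cintegralD u v : cintegrable u -> cintegrable v ->
  cintegral (fun x => u x + v x) = cintegral u + cintegral v.
Proof.
move=> [u1 u2] [v1 v2]; apply: eq_ReIm => /=.
  rewrite -(RintegralD period_measurable) //.
  by apply: eq_Rintegral => x _; rewrite cReD.
rewrite -(RintegralD period_measurable) //.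
by apply: eq_Rintegral => x _; rewrite cImD.
Qed.

Lemma cintegralZ a u : cintegrable u ->
  cintegral (fun x => a * u x) = a * cintegral u.
Proof.
move=> [u1 u2]; have pm := period_measurable.
have Z (b : R) (h : R -> R) : mu.-integrable I (EFin \o h) ->
    mu.-integrable I (EFin \o (fun x => b * h x)).
  by move=> ih; exact: (integrableZl pm b ih).
apply: eq_ReIm => /=.
  rewrite cReM /= -!(RintegralZl _ pm) // -(RintegralB pm) //; try exact: Z.
  by apply: eq_Rintegral => x _; rewrite cReM.
rewrite cImM /= -!(RintegralZl _ pm) // -(RintegralD pm) //; try exact: Z.
by apply: eq_Rintegral => x _; rewrite cImM.
Qed.

Lemma ae_eq_cintegral u v : cintegrable u -> cintegrable v ->
  {ae mu, forall x, u x = v x} -> cintegral u = cintegral v.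
Proof.
move=> [/integrableP[u1 _] /integrableP[u2 _]].
move=> [/integrableP[v1 _] /integrableP[v2 _]] uv.
apply: eq_ReIm; rewrite /= /Rintegral; congr fine;
  apply: (ae_eq_integral _ _ period_measurable) => //.
  by apply: (@filterS _ _ (ae_filter_ringOfSetsType mu)) uv => x /= ->.
by apply: (@filterS _ _ (ae_filter_ringOfSetsType mu)) uv => x /= ->.
Qed.

End Integrability.

(** * Fourier coefficients *)

Section FourierCoefficients.
Context {R : realType}.
Implicit Types (u v : R -> R[i]) (a : R[i]) (j k m : int).

Local Notation mu := (@lebesgue_measure R).
Local Notation I := (`[0, 2 * pi]%classic : set R).

Lemma Rintegral_cycle (f F : R -> R) : continuous f ->
    (forall x : R, is_derive x (1 : R) F (f x)) -> F (2 * pi) = F 0 ->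
  Rintegral mu I f = 0.
Proof.
move=> cf dF F2pi.
have cF : continuous F.
  move=> x; apply: differentiable_continuous.
  by apply/derivable1_diffP; case: (dF x).
rewrite /Rintegral (continuous_FTC2 pi2_gt0 (F := F)).
- by rewrite F2pi -EFinB subrr.
- by apply: continuous_subspaceT => x; exact: cf.
- split; first by move=> x _; case: (dF x).
  + exact/cvg_at_right_filter/cF.
  + exact/cvg_at_left_filter/cF.
- by move=> x _; rewrite derive1E; case: (dF x).
Qed.

(** For [j != 0] the components of [cexp j] have the periodic primitives
    [sin (j x) / j] and [- cos (j x) / j]. *)
Lemma cintegral_cexp j : cintegral (cexp j) =
  (if j == 0 then 2 * pi else 0 : R)%:C.
Proof.
case: eqVneq => [->|j0].
  have e1 x : cexp 0 x = 1 :> R[i] by exact: cexp0.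
  rewrite /cintegral; under eq_Rintegral do rewrite e1.
  under [X in _ +i* X]eq_Rintegral do rewrite e1.
  rewrite !(Rintegral_cst mu period_measurable) /=.
  by rewrite [mu _]period_mass /= mul1r mul0r.
have jR : (j%:~R : R) != 0 by rewrite intr_eq0.
have dj x : is_derive (x : R) (1 : R) (fun y : R => j%:~R * y) j%:~R.
  have := is_deriveZ (j%:~R : R) (is_derive_id (x : R) (1 : R)).
  by rewrite /GRing.scale /= mulr1.
have per := @cexp_periodic R j 0; rewrite add0r in per.
have c2 : cos (j%:~R * (2 * pi)) = cos (j%:~R * 0) :> R by case: per.
have s2 : sin (j%:~R * (2 * pi)) = sin (j%:~R * 0) :> R by case: per.
have cj : continuous (fun x : R => j%:~R * x).
  by move=> x; exact: mulrl_continuous.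
apply: eq_ReIm => /=.
  apply: (Rintegral_cycle (F := fun x => j%:~R^-1 * sin (j%:~R * x))).
  - move=> x; apply: continuous_comp; [exact: cj|exact: continuous_cos].
  - move=> x; have := is_deriveZ (j%:~R^-1 : R)
      (is_derive1_comp (is_derive_sin (j%:~R * x)) (dj x)).
    by rewrite /GRing.scale /= mulrC mulfK.
  - by rewrite s2.
apply: (Rintegral_cycle (F := fun x => (- j%:~R^-1) * cos (j%:~R * x))).
- move=> x; apply: continuous_comp; [exact: cj|exact: continuous_sin].
- move=> x; have := is_deriveZ (- j%:~R^-1 : R)
    (is_derive1_comp (is_derive_cos (j%:~R * x)) (dj x)).
  by rewrite /GRing.scale /= mulrC mulNr mulrN mulNr opprK mulfK.
- by rewrite c2.
Qed.

Lemma fourier_cexp j k : fourier (@cexp R j) k = (j == k)%:R.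
Proof.
rewrite /fourier /inner.
under [X in cintegral X]eq_fun do rewrite -cexpN -cexpD.
rewrite cintegral_cexp subr_eq0; case: eqP => _; last by rewrite mulr0.
by rewrite -rmorphM /= mulVf // gt_eqF // pi2_gt0.
Qed.

Lemma cintegrable_mode u j : cintegrable u ->
  cintegrable (fun x => u x * (cexp j x)^*).
Proof.
move=> iu; under eq_fun do rewrite -cexpN.
apply: (cintegrable_bdd (K := 1)) => //; first exact: cmeasurable_cexp.
by move=> x; rewrite cmod_cexp.
Qed.

Lemma fourierD u v j : cintegrable u -> cintegrable v ->
  fourier (fun x => u x + v x) j = fourier u j + fourier v j.
Proof.
move=> iu iv; rewrite /fourier /inner -mulrDr.
rewrite -(cintegralD (cintegrable_mode j iu) (cintegrable_mode j iv)).
by under eq_fun do rewrite mulrDl.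
Qed.

Lemma fourierZ a u j : cintegrable u ->
  fourier (fun x => a * u x) j = a * fourier u j.
Proof.
move=> iu; rewrite /fourier /inner mulrCA.
rewrite -(cintegralZ _ (cintegrable_mode j iu)).
by under eq_fun do rewrite -mulrA.
Qed.

Lemma ae_eq_fourier u v j : cintegrable u -> cintegrable v ->
  {ae mu, forall x, u x = v x} -> fourier u j = fourier v j.
Proof.
move=> iu iv uv; rewrite /fourier /inner; congr (_ * _).
apply: ae_eq_cintegral; [exact: cintegrable_mode..|].
by apply: (@filterS _ _ (ae_filter_ringOfSetsType mu)) uv => x /= ->.
Qed.

Lemma fourier_shift u j m :
  fourier (fun x => u x * cexp j x) (m + j) = fourier u m.
Proof.
rewrite /fourier /inner; congr (_ * cintegral _); apply/funext => x.
by rewrite -!cexpN opprD -mulrA [in cexp j x * _]mulrC -cexpD subrK.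
Qed.

Lemma cmod_cintegral_le u (g : R -> R) : cintegrable u ->
    mu.-integrable I (EFin \o g) -> (forall x, cmod (u x) <= g x) ->
  cmod (cintegral u) <= 2 * Rintegral mu I g.
Proof.
move=> [u1 u2] ig ug.
have le h : mu.-integrable I (EFin \o h) -> (forall x, `|h x| <= cmod (u x)) ->
    `|Rintegral mu I h| <= Rintegral mu I g.
  move=> ih hu; apply: (le_trans (le_normr_Rintegral period_measurable ih)).
  apply: (le_Rintegral period_measurable) => //.
    exact: (integrable_norm ih).
  by move=> x _; rewrite (le_trans (hu x)).
apply: (le_trans (cmod_le_ReIm _)); rewrite mulr_natl mulr2n.
by apply: lerD; apply: le => // x; [exact: norm_Re_le|exact: norm_Im_le].
Qed.

Lemma fourier_bounded u : cintegrable u ->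
  exists K : R, forall j, cmod (fourier u j) <= K.
Proof.
move=> iu; have [u1 u2] := iu.
pose g x : R := `|complex.Re (u x)| + `|complex.Im (u x)|.
have ig : mu.-integrable I (EFin \o g).
  exact: (integrableD period_measurable
            (integrable_norm u1) (integrable_norm u2)).
exists ((2 * pi)^-1 * (2 * Rintegral mu I g)) => j.
rewrite /fourier /inner cmodM cmod_real ger0_norm ?invr_ge0 ?(ltW pi2_gt0) //.
apply: ler_wpM2l; first by rewrite invr_ge0 (ltW pi2_gt0).
apply: cmod_cintegral_le => //; first exact: cintegrable_mode.
by move=> x; rewrite cmodM cmodC cmod_cexp mulr1 cmod_le_ReIm.
Qed.

End FourierCoefficients.

(** * Symmetric sums over the integers *)

Section SymmetricSums.
Context {R : realType}.
Implicit Types (c d : int -> R[i]) (z w : nat -> R[i]) (a l : R[i]).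

(** Convergence of complex sequences, split into components because [zsum] is
    the pair of the limits of the real and imaginary parts. *)
Definition ccvg z l : Prop :=
  ((fun N => complex.Re (z N)) @ \oo --> complex.Re l) /\
  ((fun N => complex.Im (z N)) @ \oo --> complex.Im l).

Lemma ccvg_unique z l l' : ccvg z l -> ccvg z l' -> l = l'.
Proof.
by move=> [z1 z2] [z1' z2']; apply: eq_ReIm; [move: z1 z1'|move: z2 z2'];
  apply: cvg_unique.
Qed.

Lemma ccvg_near_cst z l : (\forall N \near \oo, z N = l) -> ccvg z l.
Proof.
by move=> zl; split; apply: cvg_near_cst; apply: filterS zl => N ->.
Qed.

Lemma ccvgD z w l l' : ccvg z l -> ccvg w l' ->
  ccvg (fun N => z N + w N) (l + l').
Proof.
move=> [z1 z2] [w1 w2]; rewrite /ccvg cReD cImD; split.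
  by under eq_fun do rewrite cReD; exact: cvgD.
by under eq_fun do rewrite cImD; exact: cvgD.
Qed.

Lemma ccvgM a z l : ccvg z l -> ccvg (fun N => a * z N) (a * l).
Proof.
move=> [z1 z2]; rewrite /ccvg cReM cImM; split.
  by under eq_fun do rewrite cReM; apply: cvgB; apply: cvgMr.
by under eq_fun do rewrite cImM; apply: cvgD; apply: cvgMr.
Qed.

(** Both [y] and [y - x] are nondecreasing and bounded. *)
Lemma cvgn_dominated_increments (x y : R ^nat) (M : R) :
    (forall N, `|x N.+1 - x N| <= y N.+1 - y N) -> (forall N, y N <= M) ->
  cvgn x.
Proof.
move=> xy yM.
have x0 N : - (y N - y 0%N) <= x N - x 0%N.
  elim: N => [|N IH]; first by rewrite !subrr oppr0.
  by have := xy N; rewrite ler_norml => /andP[h _]; lra.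
have cy : cvgn y.
  apply: nondecreasing_is_cvgn.
    apply/nondecreasing_seqP => N.
    by have := le_trans (normr_ge0 _) (xy N); rewrite subr_ge0.
  by exists M => _ [N _ <-].
have cyx : cvgn (fun N => y N - x N).
  apply: nondecreasing_is_cvgn.
    apply/nondecreasing_seqP => N.
    by have := xy N; rewrite ler_norml => /andP[_ h]; lra.
  exists (M + (M - y 0%N - x 0%N)) => _ [N _ <-].
  by have := x0 N; have := yM N; lra.
have -> : x = (fun N => y N - (y N - x N)) by apply/funext => N; lra.
exact: is_cvgB.
Qed.

Definition zpart c (N : nat) : R[i] := \sum_(k < (N.*2).+1) c (k%:Z - N%:Z).

Lemma zpartS c N : zpart c N.+1 = zpart c N + (c N.+1%:Z + c (- N.+1%:Z)).
Proof.
rewrite /zpart doubleS big_ord_recl big_ord_recr /= /bump /= !add1n.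
rewrite [c (0%:Z - _)](_ : _ = c (- N.+1%:Z)); last by rewrite sub0r.
rewrite [c (N.*2.+2%:Z - _)](_ : _ = c N.+1%:Z); last first.
  by congr c; rewrite -addnn; lia.
rewrite [LHS]addrC -addrA; congr (_ + _); apply: eq_bigr => k _ /=.
by congr c; rewrite /bump /=; lia.
Qed.

Lemma zpartD c d N : zpart (fun m => c m + d m) N = zpart c N + zpart d N.
Proof. by rewrite /zpart big_split. Qed.

Lemma zpartM a c N : zpart (fun m => a * c m) N = a * zpart c N.
Proof. by rewrite /zpart mulr_sumr. Qed.

(** A telescoping majorant of [1 + 2 * (1 + 1/4 + ... + 1/N^2)], obtained from
    [1/t^2 <= 2/t - 2/(t + 1)]: it equals [1] at [N = 0] and stays below [5]. *)
Definition sq_majorant (N : nat) : R := 5 - 4 / N.+1%:R.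

Lemma sq_majorantS N : 2 / N.+1%:R ^+ 2 <= sq_majorant N.+1 - sq_majorant N.
Proof.
rewrite /sq_majorant -[N.+2]addn1 natrD; set t : R := N.+1%:R.
have t1 : 1 <= t by rewrite ler1n.
have -> : 5 - 4 / (t + 1) - (5 - 4 / t) =
          2 / t ^+ 2 + (2 * t - 2) / (t ^+ 2 * (t + 1)).
  by field; apply/andP; split; lra.
rewrite lerDl divr_ge0 //; first lra.
by rewrite mulr_ge0 ?sqr_ge0 //; lra.
Qed.

Lemma sq_majorant_le5 N : sq_majorant N <= 5.
Proof. by rewrite /sq_majorant gerBl divr_ge0. Qed.

(** The quantitative form of absolute summability that the symbol
    [1 / (lam - m^2)] provides; the constant is explicit so that bounds on the
    partial sums are uniform in [x]. *)
Definition sq_decay (K : R) c : Prop :=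
  forall m, cmod (c m) <= K / bracket R m ^+ 2.

Lemma sq_decay_bound_ge0 K c : sq_decay K c -> 0 <= K.
Proof.
move=> /(_ 0); rewrite /bracket rmorph0 normr0 max_l ?ler01 // expr1n divr1.
exact: le_trans (cmod_ge0 _).
Qed.

Lemma sq_decay_pair K c N : sq_decay K c ->
  cmod (c N.+1%:Z + c (- N.+1%:Z)) <=
    K * sq_majorant N.+1 - K * sq_majorant N.
Proof.
move=> cK; rewrite -mulrBr.
apply: (le_trans (ler_cmodD _ _)).
apply: le_trans (ler_wpM2l (sq_decay_bound_ge0 cK) (sq_majorantS N)).
have h1 := cK N.+1%:Z; have := cK (- N.+1%:Z); rewrite bracketN => h2.
apply: (le_trans (lerD h1 h2)); rewrite bracketS.
by rewrite mulrA [K * 2]mulr_natr mulr2n mulrDl.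
Qed.

Lemma zpart_bounded K c N : sq_decay K c -> cmod (zpart c N) <= 5 * K.
Proof.
move=> cK; have K0 := sq_decay_bound_ge0 cK.
suff h : cmod (zpart c N) <= K * sq_majorant N.
  rewrite [5 * K]mulrC; exact: le_trans h (ler_wpM2l K0 (sq_majorant_le5 N)).
elim: N => [|N IH].
  rewrite /zpart big_ord_recl big_ord0 addr0 subr0 /sq_majorant.
  have := cK 0; rewrite /bracket rmorph0 normr0 max_l ?ler01 // expr1n !divr1.
  by lra.
rewrite zpartS; apply: (le_trans (ler_cmodD _ _)).
by have := sq_decay_pair N cK; lra.
Qed.

Lemma zpart_cvg K c : sq_decay K c -> ccvg (zpart c) (zsum c).
Proof.
move=> cK.
have yM N : K * sq_majorant N <= K * 5.
  by rewrite ler_wpM2l ?sq_majorant_le5 ?(sq_decay_bound_ge0 cK).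
split.
  apply: cvgn_dominated_increments yM => N.
  rewrite zpartS cReD addrC addKr.
  exact: le_trans (norm_Re_le _) (sq_decay_pair N cK).
apply: cvgn_dominated_increments yM => N.
rewrite zpartS cImD addrC addKr.
exact: le_trans (norm_Im_le _) (sq_decay_pair N cK).
Qed.

Lemma zsumD K K' c d : sq_decay K c -> sq_decay K' d ->
  zsum (fun m => c m + d m) = zsum c + zsum d.
Proof.
move=> cK dK.
have cdK : sq_decay (K + K') (fun m => c m + d m).
  move=> m; apply: (le_trans (ler_cmodD _ _)); rewrite mulrDl.
  exact: lerD.
apply: ccvg_unique (zpart_cvg cdK) _.
have -> : zpart (fun m => c m + d m) = (fun N => zpart c N + zpart d N).
  by apply/funext => N; rewrite zpartD.
exact: ccvgD (zpart_cvg cK) (zpart_cvg dK).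
Qed.

Lemma zsumM K a c : sq_decay K c -> zsum (fun m => a * c m) = a * zsum c.
Proof.
move=> cK.
have acK : sq_decay (cmod a * K) (fun m => a * c m).
  by move=> m; rewrite cmodM -mulrA ler_wpM2l ?cmod_ge0.
apply: ccvg_unique (zpart_cvg acK) _.
have -> : zpart (fun m => a * c m) = (fun N => a * zpart c N).
  by apply/funext => N; rewrite zpartM.
exact: (ccvgM a (zpart_cvg cK)).
Qed.

Lemma zsum_bounded K c : sq_decay K c -> cmod (zsum c) <= 10 * K.
Proof.
move=> cK; have [c1 c2] := zpart_cvg cK.
have bnd (x : R ^nat) y :
    (forall N, `|x N| <= 5 * K) -> x @ \oo --> y -> `|y| <= 5 * K.
  move=> xK xy; apply: (cvgr_to_le (cvg_norm xy)); exact: nearW.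
have r1 : `|complex.Re (zsum c)| <= 5 * K.
  apply: bnd c1 => N; exact: le_trans (norm_Re_le _) (zpart_bounded N cK).
have r2 : `|complex.Im (zsum c)| <= 5 * K.
  apply: bnd c2 => N; exact: le_trans (norm_Im_le _) (zpart_bounded N cK).
by apply: (le_trans (cmod_le_ReIm _)); lra.
Qed.

End SymmetricSums.

(** * Fourier series with quadratically decaying coefficients *)

Section FourierSeries.
Context {R : realType}.
Implicit Types (c : int -> R[i]) (K : R) (j k m : int).

Local Notation mu := (@lebesgue_measure R).
Local Notation I := (`[0, 2 * pi]%classic : set R).

Definition fseries c (x : R) : R[i] := zsum (fun m => c m * cexp m x).

Definition trigpoly c (N : nat) (x : R) : R[i] :=
  zpart (fun m => c m * cexp m x) N.

Lemma sq_decay_mode K c x :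
  sq_decay K c -> sq_decay K (fun m => c m * cexp m x).
Proof. by move=> cK m; rewrite cmodM cmod_cexp mulr1. Qed.

Lemma cmod_fseries_le K c x : sq_decay K c -> cmod (fseries c x) <= 10 * K.
Proof. by move=> cK; apply: zsum_bounded; exact: sq_decay_mode. Qed.

Lemma fseries_periodic c x : fseries c (x + 2 * pi) = fseries c x.
Proof.
rewrite /fseries; congr zsum; apply/funext => m.
by rewrite cexp_periodic.
Qed.

Lemma trigpoly_measurable c N : cmeasurable (trigpoly c N).
Proof.
rewrite /trigpoly /zpart; elim: (N.*2.+1) => [|p IH].
  under eq_fun do rewrite big_ord0; exact: cmeasurable_cst.
under eq_fun do rewrite big_ord_recr; apply: cmeasurableD => //=.
by apply: cmeasurableM; [exact: cmeasurable_cst|exact: cmeasurable_cexp].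
Qed.

Lemma fourier_sum (f : nat -> R -> R[i]) (p : nat) k :
    (forall i, cintegrable (f i)) ->
  cintegrable (fun x => \sum_(i < p) f i x) /\
  fourier (fun x => \sum_(i < p) f i x) k = \sum_(i < p) fourier (f i) k.
Proof.
move=> fi; elim: p => [|p [IH1 IH2]].
  have e0 : (fun x : R => \sum_(i < 0) f i x) = (fun x => 0 * cexp 0 x).
    by apply/funext => x; rewrite big_ord0 mul0r.
  rewrite e0 big_ord0 fourierZ; last exact: cintegrable_cexp.
  by rewrite mul0r; split => //; apply: cintegrableZ; exact: cintegrable_cexp.
have eS : (fun x : R => \sum_(i < p.+1) f i x) =
          (fun x => \sum_(i < p) f i x + f p x).
  by apply/funext => x; rewrite big_ord_recr.
by rewrite eS big_ord_recr fourierD // IH2; split => //; exact: cintegrableD.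
Qed.

Lemma fourier_trigpoly c N k :
  fourier (trigpoly c N) k = zpart (fun m => c m * (m == k)%:R) N.
Proof.
pose f (i : nat) x : R[i] := c (i%:Z - N%:Z) * cexp (i%:Z - N%:Z) x.
have fi i : cintegrable (f i) by apply: cintegrableZ; exact: cintegrable_cexp.
have [_] := fourier_sum (N.*2.+1) k fi; rewrite /trigpoly /zpart => ->.
apply: eq_bigr => i _; rewrite /f fourierZ; last exact: cintegrable_cexp.
by rewrite fourier_cexp.
Qed.

Lemma zpart_delta c k N : (`|k| <= N)%N ->
  zpart (fun m => c m * (m == k)%:R) N = c k.
Proof.
move=> kN; rewrite /zpart.
have ltp : (`|(k + N%:Z)%R|%N < N.*2.+1)%N by rewrite -addnn; lia.
have ep : (Ordinal ltp)%:Z - N%:Z = k by rewrite /=; lia.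
rewrite (bigD1 (Ordinal ltp)) //= big1 ?addr0.
  by rewrite (_ : _ - _ = k) ?eqxx ?mulr1 //; lia.
move=> i; apply: contraNeq; rewrite mulf_eq0 negb_or pnatr_eq0 eqb0 negbK.
move=> /andP[_ /eqP ik]; apply/eqP/val_inj => /=; lia.
Qed.

Lemma trigpoly_cvg K c x : sq_decay K c ->
  ccvg (fun N => trigpoly c N x) (fseries c x).
Proof. by move=> cK; exact: zpart_cvg (sq_decay_mode x cK). Qed.

Lemma fseries_measurable K c : sq_decay K c -> cmeasurable (fseries c).
Proof.
move=> cK; split.
  apply: (@measurable_fun_cvg _ _ _ _ (fun N x => complex.Re (trigpoly c N x))).
    by move=> N; case: (trigpoly_measurable c N).
  by move=> x _; case: (trigpoly_cvg x cK).
apply: (@measurable_fun_cvg _ _ _ _ (fun N x => complex.Im (trigpoly c N x))).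
  by move=> N; case: (trigpoly_measurable c N).
by move=> x _; case: (trigpoly_cvg x cK).
Qed.

Lemma fseries_in_L2 K c : sq_decay K c -> in_L2 (fseries c).
Proof.
move=> cK; apply: (@in_L2_bounded _ _ (10 * K)).
- exact: fseries_periodic.
- exact: fseries_measurable cK.
- by move=> x; exact: cmod_fseries_le.
Qed.

Lemma Rintegral_bounded_cvg (f_ : nat -> R -> R) (f : R -> R) K :
    (forall N, measurable_fun setT (f_ N)) -> (forall N x, `|f_ N x| <= K) ->
    (forall x, f_ ^~ x @ \oo --> f x) ->
  (fun N => Rintegral mu I (f_ N)) @ \oo --> Rintegral mu I f.
Proof.
move=> mf fK ff.
have mfI N : measurable_fun I (EFin \o f_ N).
  by apply/measurable_EFinP; exact: measurable_funTS.
have := dominated_cvg period_measurable (f_ := fun N => EFin \o f_ N)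
  (f := EFin \o f) (g := EFin \o cst K) (mu := mu) _ _ _
  (integrable_period_cst K).
have mf' : measurable_fun setT f by exact: (measurable_fun_cvg mf).
have fK' x : `|f x| <= K.
  by apply: (cvgr_to_le (cvg_norm (ff x))); exact: nearW.
have iI : mu.-integrable I (EFin \o f).
  apply: (le_integrable period_measurable _ _ (integrable_period_cst K)).
    by apply/measurable_EFinP; exact: measurable_funTS.
  by move=> x _; rewrite /= lee_fin (le_trans (fK' x)) // ler_norm.
move=> h; rewrite /Rintegral; apply: fine_cvg; rewrite fineK; last first.
  exact: (integrable_fin_num period_measurable).
apply: h => //.
- by move=> x _; apply: cvg_EFin; [exact: nearW|exact: ff].
- by move=> N x _ /=; rewrite lee_fin.
Qed.

(** The partial sums are bounded uniformly in [N] and [x], so that dominated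
    convergence allows term-by-term integration; beyond [N = |k|] the [k]-th
    coefficient of the partial sum is constant. *)
Lemma fourier_fseries K c k : sq_decay K c -> fourier (fseries c) k = c k.
Proof.
move=> cK.
pose g_ N x := trigpoly c N x * (cexp k x)^*.
pose g x := fseries c x * (cexp k x)^*.
have gm N : cmeasurable (g_ N).
  rewrite /g_; under eq_fun do rewrite -cexpN.
  by apply: cmeasurableM; [exact: trigpoly_measurable|exact: cmeasurable_cexp].
have gb N x : cmod (g_ N x) <= 5 * K.
  rewrite cmodM cmodC cmod_cexp mulr1.
  exact: zpart_bounded (sq_decay_mode x cK).
have gg x : ccvg (g_ ^~ x) (g x).
  rewrite /g_ /g mulrC; under eq_fun do rewrite mulrC.
  exact: (ccvgM _ (trigpoly_cvg x cK)).
have ig : ccvg (fun N => cintegral (g_ N)) (cintegral g).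
  split; apply: (Rintegral_bounded_cvg (K := 5 * K)).
  - by move=> N; case: (gm N).
  - by move=> N x; exact: le_trans (norm_Re_le _) (gb N x).
  - by move=> x; case: (gg x).
  - by move=> N; case: (gm N).
  - by move=> N x; exact: le_trans (norm_Im_le _) (gb N x).
  - by move=> x; case: (gg x).
have : ccvg (fun N => fourier (trigpoly c N) k) (fourier (fseries c) k).
  exact: (ccvgM _ ig).
move=> /ccvg_unique; apply; apply: ccvg_near_cst.
exists `|k|%N => // N /= kN.
by rewrite fourier_trigpoly zpart_delta.
Qed.

End FourierSeries.

(** * The reduced operator *)

Section ReducedOperator.
Context {R : realType}.
Implicit Types (u v w g : R -> R[i]) (a lam : R[i]) (j k m : int).

Local Notation mu := (@lebesgue_measure R).
Local Notation I := (`[0, 2 * pi]%classic : set R).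

Lemma in_L2D u v : in_L2 u -> in_L2 v -> in_L2 (fun x => u x + v x).
Proof.
move=> [up u1 u2 iu] [vp v1 v2 iv]; split.
- by move=> x; rewrite up vp.
- by under eq_fun do rewrite cReD; exact: measurable_funD.
- by under eq_fun do rewrite cImD; exact: measurable_funD.
have i2 := integrableZl period_measurable 2
  (integrableD period_measurable iu iv).
apply: (le_integrable period_measurable _ _ i2).
  apply/measurable_EFinP; apply: measurable_funTS.
  by apply: cmeasurable_sqr_cmod; exact: cmeasurableD.
move=> x _ /=; rewrite lee_fin ger0_norm ?sqr_ge0 //.
apply: le_trans (ler_norm _).
(* [(p + q)^2 <= 2 (p^2 + q^2)] *)
have := ler_cmodD (u x) (v x); have := cmod_ge0 (u x + v x).
move: (cmod (u x + v x)) (cmod (u x)) (cmod (v x)) => r p q r0 rpq.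
have rr : r ^+ 2 <= (p + q) ^+ 2 by rewrite lerXn2r ?nnegrE // (le_trans r0).
by apply: (le_trans rr); have := sqr_ge0 (p - q); nra.
Qed.

Lemma in_L2Z a u : in_L2 u -> in_L2 (fun x => a * u x).
Proof.
move=> uL; have [up u1 u2 iu] := uL.
have [m1 m2] : cmeasurable (fun x => a * u x).
  by apply: cmeasurableM; [exact: cmeasurable_cst|].
split => //; first by move=> x; rewrite up.
under [X in _.-integrable _ X]eq_fun do rewrite cmodM exprMn EFinM.
exact: (integrableZl period_measurable).
Qed.

(** Beyond [|m| >= 2 |lam|] the symbol is at most [2 / m^2]; the finitely many
    other modes only affect the constant. *)
Lemma symbol_decay lam : exists L, sq_decay L (fun m => (lam - m%:~R ^+ 2)^-1).
Proof.
pose h m : R := cmod ((lam - m%:~R ^+ 2)^-1) * bracket R m ^+ 2.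
have h0 m : 0 <= h m by rewrite mulr_ge0 ?cmod_ge0 ?sqr_ge0.
have [M lamM] : exists M : nat, 2 * cmod lam <= M%:R.
  by exists (Num.Def.archi_bound (2 * cmod lam)); apply: ltW;
    apply: archi_boundP; rewrite mulr_ge0 ?cmod_ge0.
pose S := \sum_(i < M.*2.+1) h (i%:Z - M%:Z).
have S0 : 0 <= S by apply: sumr_ge0.
exists (2 + S) => m; rewrite ler_pdivlMr ?exprn_gt0 ?bracket_gt0 // -/(h m).
case: (leqP `|m|%N M) => mM.
  have ltp : (`|(m + M%:Z)%R|%N < M.*2.+1)%N by rewrite -addnn; lia.
  have ep : (Ordinal ltp)%:Z - M%:Z = m by rewrite /=; lia.
  rewrite -[in h m]ep /S (bigD1 (Ordinal ltp)) //=.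
  have : 0 <= \sum_(i < M.*2.+1 | i != Ordinal ltp) h (i%:Z - M%:Z).
    by apply: sumr_ge0.
  by lra.
pose t : R := `|m|%N%:R.
have mt : `|m%:~R| = t :> R by rewrite -intr_norm /t pmulrn abszE.
have t1 : M%:R + 1 <= t by rewrite /t natr1 ler_nat.
have M0 : 0 <= M%:R :> R by [].
have bt : bracket R m = t by rewrite /bracket mt max_r //; lra.
have ct : cmod (m%:~R ^+ 2 : R[i]) = t ^+ 2.
  rewrite -(rmorph_int (real_complex R)) -rmorphXn cmod_real normrX mt //.
have low : t ^+ 2 / 2 <= cmod (lam - m%:~R ^+ 2).
  have := ler_cmodD (m%:~R ^+ 2 - lam) lam; rewrite subrK ct.
  have tt : t <= t ^+ 2 by rewrite expr2 ler_peMl //; lra.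
  by rewrite cmodB; lra.
have t2 : 0 < t ^+ 2 by rewrite exprn_gt0 //; lra.
rewrite /h cmodV bt -[leLHS]mulrC ler_pdivrMr; last by lra.
rewrite mulrDl.
have : 0 <= S * cmod (lam - m%:~R ^+ 2) by rewrite mulr_ge0 ?cmod_ge0.
by lra.
Qed.

(** The coefficients of an integrable function are bounded, so the symbol alone
    makes the series defining [Ainv] converge absolutely. *)
Lemma Ainv_decay lam g : cintegrable g ->
  exists K, sq_decay K (fun m => (lam - m%:~R ^+ 2)^-1 * fourier g m).
Proof.
move=> /fourier_bounded[K gK]; have [L lamL] := symbol_decay lam.
exists (L * K) => m; rewrite cmodM mulrAC.
by apply: ler_pM; rewrite ?cmod_ge0.
Qed.

Lemma AinvE lam g :
  Ainv lam g = fseries (fun m => (lam - m%:~R ^+ 2)^-1 * fourier g m).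
Proof. by []. Qed.

Lemma fourier_Ainv lam g k : cintegrable g ->
  fourier (Ainv lam g) k = (lam - k%:~R ^+ 2)^-1 * fourier g k.
Proof.
by move=> /(Ainv_decay lam)[K gK]; rewrite AinvE (fourier_fseries _ gK).
Qed.

Lemma Ainv_in_L2 lam g : cintegrable g -> in_L2 (Ainv lam g).
Proof.
by move=> /(Ainv_decay lam)[K gK]; rewrite AinvE; exact: fseries_in_L2 gK.
Qed.

Lemma AinvD lam u v : cintegrable u -> cintegrable v ->
  Ainv lam (fun x => u x + v x) = (fun x => Ainv lam u x + Ainv lam v x).
Proof.
move=> iu iv; have [K uK] := Ainv_decay lam iu.
have [K' vK] := Ainv_decay lam iv.
apply/funext => x; rewrite !AinvE /fseries.
rewrite -(zsumD (sq_decay_mode x uK) (sq_decay_mode x vK)).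
by congr zsum; apply/funext => m; rewrite fourierD // mulrDr mulrDl.
Qed.

Lemma AinvZ lam a u : cintegrable u ->
  Ainv lam (fun x => a * u x) = (fun x => a * Ainv lam u x).
Proof.
move=> iu; have [K uK] := Ainv_decay lam iu.
apply/funext => x; rewrite !AinvE /fseries.
rewrite -(zsumM a (sq_decay_mode x uK)).
by congr zsum; apply/funext => m; rewrite fourierZ // !mulrA [a * _]mulrC.
Qed.

Lemma cintegrable_Pn n u : cintegrable (Pn n u).
Proof.
by apply: cintegrableD; apply: cintegrableZ; exact: cintegrable_cexp.
Qed.

Lemma Qn_cintegrable n u : cintegrable u -> cintegrable (Qn n u).
Proof.
move=> iu; rewrite /Qn; under eq_fun do rewrite -mulN1r.
by apply: cintegrableD => //; apply: cintegrableZ; exact: cintegrable_Pn.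
Qed.

Lemma QnD n u v : cintegrable u -> cintegrable v ->
  Qn n (fun x => u x + v x) = (fun x => Qn n u x + Qn n v x).
Proof.
by move=> iu iv; apply/funext => x; rewrite /Qn /Pn !fourierD //; ring.
Qed.

Lemma QnZ n a u : cintegrable u ->
  Qn n (fun x => a * u x) = (fun x => a * Qn n u x).
Proof.
by move=> iu; apply/funext => x; rewrite /Qn /Pn !fourierZ //; ring.
Qed.

Lemma fourier_Qn n u k : (1 <= n)%N -> cintegrable u -> `|k|%N = n ->
  fourier (Qn n u) k = 0.
Proof.
move=> n1 iu kn; rewrite /Qn.
have -> : (fun x => u x - Pn n u x) = (fun x => u x + (-1) * Pn n u x).
  by apply/funext => x; rewrite mulN1r.
rewrite fourierD //; last exact/cintegrableZ/cintegrable_Pn.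
rewrite fourierZ; last exact: cintegrable_Pn.
rewrite /Pn fourierD; try by apply: cintegrableZ; exact: cintegrable_cexp.
rewrite !fourierZ; try exact: cintegrable_cexp.
rewrite !fourier_cexp.
have [->|->] : k = n%:Z \/ k = - n%:Z by lia.
  have /negPf -> : - n%:Z != n%:Z by apply/eqP; lia.
  by rewrite eqxx mulr1 mulr0 addr0 mulN1r subrr.
have /negPf -> : n%:Z != - n%:Z by apply/eqP; lia.
by rewrite eqxx mulr1 mulr0 add0r mulN1r subrr.
Qed.

Lemma Tn_in_L2 q n lam w : in_L2 q -> in_L2 w -> in_L2 (Tn q n lam w).
Proof. by move=> qL wL; apply/Ainv_in_L2/Qn_cintegrable/cintegrableM. Qed.

Lemma TnD q n lam u v : in_L2 q -> in_L2 u -> in_L2 v ->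
  Tn q n lam (fun x => u x + v x) = (fun x => Tn q n lam u x + Tn q n lam v x).
Proof.
move=> qL uL vL; have iu := cintegrableM qL uL; have iv := cintegrableM qL vL.
have eV : V q (fun x => u x + v x) = (fun x => V q u x + V q v x).
  by apply/funext => x; rewrite /V mulrDr.
rewrite /Tn eV (QnD n iu iv).
by rewrite (AinvD lam (Qn_cintegrable n iu) (Qn_cintegrable n iv)).
Qed.

Lemma TnZ q n lam a u : in_L2 q -> in_L2 u ->
  Tn q n lam (fun x => a * u x) = (fun x => a * Tn q n lam u x).
Proof.
move=> qL uL; have iu := cintegrableM qL uL.
have eV : V q (fun x => a * u x) = (fun x => a * V q u x).
  by apply/funext => x; rewrite /V mulrCA.
by rewrite /Tn eV (QnZ n a iu) (AinvZ lam a (Qn_cintegrable n iu)).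
Qed.

(** Null sets disappear in the Fourier coefficients of [q u], the only data on
    which [Tn q n lam u] depends; hence the values agree at every point. *)
Lemma ae_eq_Tn q n lam u v : in_L2 q -> in_L2 u -> in_L2 v ->
  {ae mu, forall x, u x = v x} -> Tn q n lam u = Tn q n lam v.
Proof.
move=> qL uL vL uv.
have iu := cintegrableM qL uL; have iv := cintegrableM qL vL.
have quv k : fourier (V q u) k = fourier (V q v) k.
  apply: ae_eq_fourier => //.
  apply: (@filterS _ _ (ae_filter_ringOfSetsType mu)) uv => x /=.
  by rewrite /V => ->.
have Quv k : fourier (Qn n (V q u)) k = fourier (Qn n (V q v)) k.
  apply: ae_eq_fourier; [exact: Qn_cintegrable..|].
  apply: (@filterS _ _ (ae_filter_ringOfSetsType mu)) uv => x /= uvx.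
  by rewrite /Qn /Pn !quv /V uvx.
have eF : fourier (Qn n (V q u)) = fourier (Qn n (V q v)) by apply/funext.
by rewrite /Tn /Ainv eF.
Qed.

(** [Qn] removes the modes [n] and [- n], and [Ainv] acts mode by mode. *)
Lemma fourier_Tn_resonant q n lam w k : (1 <= n)%N -> in_L2 q -> in_L2 w ->
  `|k|%N = n -> fourier (Tn q n lam w) k = 0.
Proof.
move=> n1 qL wL kn; have iw := cintegrableM qL wL.
rewrite /Tn fourier_Ainv; last exact: Qn_cintegrable.
by rewrite fourier_Qn // mulr0.
Qed.

End ReducedOperator.

(** * Shifted Sobolev norms *)

Section SobolevNorms.
Context {R : realType}.
Implicit Types (u v w : R -> R[i]) (s : R) (j k m : int).

Local Notation sterm s u :=
  (fun k : int => (bracket R k `^ (2 * s) * cmod (fourier u k) ^+ 2)%:E).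

Lemma sterm_ge0 s u k : (0 <= sterm s u k)%E.
Proof. by rewrite lee_fin mulr_ge0 ?powR_ge0 ?sqr_ge0. Qed.

Lemma sterm_sqrt s u k : poweR (sterm s u k) 2^-1 =
  (bracket R k `^ s * cmod (fourier u k))%:E.
Proof.
rewrite poweR_EFin powRM ?powR_ge0 ?sqr_ge0 // -powRrM mulrAC mulfV // mul1r.
by rewrite -powR_mulrn ?cmod_ge0 // -powRrM mulfV // powRr1 // cmod_ge0.
Qed.

Lemma snorm_ge0 s u : (0 <= snorm s u)%E.
Proof. exact: poweR_ge0. Qed.

Lemma coef_le_snorm s u k :
  ((bracket R k `^ s * cmod (fourier u k))%:E <= snorm s u)%E.
Proof.
rewrite -sterm_sqrt /snorm; apply: gt0_ler_poweR.
- by rewrite invr_ge0.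
- by rewrite in_itv /= sterm_ge0 leey.
- by rewrite in_itv /= esum_ge0 ?leey // => i _; exact: sterm_ge0.
apply: esum_ge; exists [set k]; first by split.
by rewrite fsbig_set1.
Qed.

Lemma snorm_cexp s j : snorm s (@cexp R j) = (bracket R j `^ s)%:E.
Proof.
rewrite /snorm (_ : \esum_(i in _) _ = sterm s (cexp j) j).
  by rewrite sterm_sqrt fourier_cexp eqxx cmod1 mulr1.
rewrite (esumID [set j]); last by move=> i _; exact: sterm_ge0.
rewrite setTI esum_set1 ?sterm_ge0 // esum1 ?adde0 //.
move=> i [_ /= ij]; rewrite fourier_cexp (_ : j == i = false).
  by rewrite cmod0 expr0n mulr0.
by apply/eqP => ji; apply: ij.
Qed.

Lemma shifted_snorm0 s u : shifted_snorm s 0 u = snorm s u.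
Proof.
by rewrite /shifted_snorm; congr snorm; apply/funext => x; rewrite cexp0 mulr1.
Qed.

Lemma coef_le_shifted_snorm s j u m :
  ((bracket R (m + j) `^ s * cmod (fourier u m))%:E <= shifted_snorm s j u)%E.
Proof. by rewrite -(fourier_shift u j m); exact: coef_le_snorm. Qed.

(** The shift recentres the mode [j] at [0], where the weight is [1]. *)
Lemma shifted_snorm_cexp s j : shifted_snorm s (- j) (@cexp R j) = 1%E.
Proof.
rewrite /shifted_snorm.
have -> : (fun x : R => cexp j x * cexp (- j) x) = cexp 0.
  by apply/funext => x; rewrite -cexpD subrr.
by rewrite snorm_cexp bracket0 powR1.
Qed.

Lemma cexp_in_Hs s j : in_Hs s (@cexp R j).
Proof. by split; [exact: in_L2_cexp|rewrite snorm_cexp ltry]. Qed.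

(** A bound on a norm shifted by [j] yields decay away from the mode [- j]. *)
Lemma coef_le_of_shifted_snorm s j u m (K : R) :
    (shifted_snorm s j u <= K%:E)%E ->
  cmod (fourier u m) <= K * bracket R (m + j) `^ (- s).
Proof.
move=> uK; have := le_trans (coef_le_shifted_snorm s j u m) uK.
by rewrite lee_fin powRN ler_pdivlMr ?powR_gt0 ?bracket_gt0 // mulrC.
Qed.

End SobolevNorms.

(** * Iterating the reduced operator *)

Section Iteration.
Context {R : realType}.
Implicit Types (w : R -> R[i]) (j m : int).

Local Notation mu := (@lebesgue_measure R).

(** [C / n * snorm s q <= 1 / 2], for all the shifts at once. *)
Lemma Tn_contraction (s C : R) (n : nat) (q : R -> R[i]) (lam : R[i]) :
    (1 <= n)%N -> in_Hs s q -> real_valued q -> 0 < C -> Tn_bound s C ->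
    (snorm s q <= (n%:R / (2 * C))%:E)%E -> in_Un n lam ->
  forall j w, in_Hs s w ->
  (shifted_snorm s j (Tn q n lam w) <= (2^-1)%:E * shifted_snorm s j w)%E.
Proof.
move=> n1 qH qr C0 CT qs lamU j w wH.
apply: (le_trans (CT n q n1 qH qr lam j w lamU wH)).
apply: lee_wpmul2r; first exact: snorm_ge0.
have n0 : 0 < n%:R :> R by rewrite ltr0n.
apply: (@le_trans _ _ ((C / n%:R)%:E * (n%:R / (2 * C))%:E)%E).
  by apply: lee_wpmul2l => //; rewrite lee_fin divr_ge0 // ltW.
rewrite -EFinM lee_fin; suff -> : C / n%:R * (n%:R / (2 * C)) = 2^-1 by [].
by field; rewrite !gt_eqF.
Qed.

(** The radius of [D_n] is at most [n / 3]. *)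
Lemma in_Dn_Un (s C : R) (n : nat) (q : R -> R[i]) (lam : R[i]) : 0 < C ->
    (snorm s q <= (n%:R / (2 * C))%:E)%E -> in_Dn s C q n lam -> in_Un n lam.
Proof.
move=> C0 qs; rewrite /in_Dn /in_Un => lamD.
have : ((cmod (lam - n%:R ^+ 2))%:E <= (2 * C / 3)%:E * (n%:R / (2 * C))%:E)%E.
  apply: (le_trans lamD); apply: lee_wpmul2l => //.
  by rewrite lee_fin; apply: divr_ge0 => //; apply: mulr_ge0 => //; exact: ltW.
rewrite -EFinM lee_fin => h; apply: (le_trans h).
have -> : 2 * C / 3 * (n%:R / (2 * C)) = n%:R / 3 by field; rewrite gt_eqF.
by have : 0 <= n%:R :> R by []; lra.
Qed.

(** All the shifts [j] are bounded together, since [e_n] and [e_(-n)] are measured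
    with different shifts. *)
Definition iterates_halve (s : R) (T : (R -> R[i]) -> R -> R[i]) : Prop :=
  forall (N : nat) w, in_Hs s w -> in_Hs s (iter N T w) /\
  forall j, (shifted_snorm s j (iter N T w) <=
    (2^-1 ^+ N)%:E * shifted_snorm s j w)%E.

(** The bound at shift [0] also keeps the iterates in [H^s], where the bound can
    be applied again. *)
Lemma iter_Tn (s : R) (n : nat) (q : R -> R[i]) (lam : R[i]) : in_Hs s q ->
    (forall j w, in_Hs s w -> (shifted_snorm s j (Tn q n lam w) <=
                                 (2^-1)%:E * shifted_snorm s j w)%E) ->
  iterates_halve s (Tn q n lam).
Proof.
move=> qH T2 N w wH; elim: N => [|N [IH1 IH2]].
  by split => // j; rewrite expr0 mul1e.
split.
  split; first by rewrite iterS; apply: Tn_in_L2; [case: qH|case: IH1].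
  rewrite iterS -shifted_snorm0; apply: (le_lt_trans (T2 _ _ IH1)).
  have [_] := IH1; rewrite shifted_snorm0.
  have := snorm_ge0 s (iter N (Tn q n lam) w).
  by case: (snorm _ _) => [r| |] // _ _; rewrite -EFinM ltry.
move=> j; rewrite iterS; apply: (le_trans (T2 _ _ IH1)).
rewrite exprS EFinM -muleA; apply: lee_wpmul2l; last exact: IH2.
by rewrite lee_fin invr_ge0.
Qed.

(** Applying [T] repeatedly to [w = T w + a T e + b T e'] and adding up gives a
    finite Neumann expansion with remainder [T^N w].  The equation holds almost
    everywhere; one application of [T] makes it hold at every point. *)
Lemma unroll_resolvent (T : (R -> R[i]) -> R -> R[i]) (w e e' : R -> R[i])
    (a b : R[i]) :
    (forall u, in_L2 u -> in_L2 (T u)) ->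
    (forall u v, in_L2 u -> in_L2 v ->
      {ae mu, forall x, u x = v x} -> T u = T v) ->
    (forall u v, in_L2 u -> in_L2 v ->
      T (fun x => u x + v x) = (fun x => T u x + T v x)) ->
    (forall c u, in_L2 u -> T (fun x => c * u x) = (fun x => c * T u x)) ->
    in_L2 w -> in_L2 e -> in_L2 e' ->
    {ae mu, forall x, w x = T w x + (a * T e x + b * T e' x)} ->
  forall (N : nat) m, fourier w m = fourier (iter N T w) m +
    \sum_(k < N) (a * fourier (iter k.+1 T e) m +
                  b * fourier (iter k.+1 T e') m).
Proof.
move=> TL2 Tae TD TZ wL eL e'L weq.
have TL N u : in_L2 u -> in_L2 (iter N T u).
  by move=> uL; elim: N => // N IH; exact: TL2.
have sL N : in_L2 (fun x => a * iter N.+1 T e x + b * iter N.+1 T e' x).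
  by apply: in_L2D; apply: in_L2Z; exact: TL.
have step N : {ae mu, forall x, iter N T w x = iter N.+1 T w x +
    (a * iter N.+1 T e x + b * iter N.+1 T e' x)}.
  elim: N => [|N IH]; first exact: weq.
  apply: aeW => x; rewrite iterS.
  rewrite (Tae _ _ (TL N w wL) (in_L2D (TL N.+1 w wL) (sL N)) IH).
  rewrite (TD _ _ (TL N.+1 w wL) (sL N)).
  rewrite (TD _ _ (in_L2Z a (TL N.+1 e eL)) (in_L2Z b (TL N.+1 e' e'L))).
  by rewrite (TZ a _ (TL N.+1 e eL)) (TZ b _ (TL N.+1 e' e'L)).
have cL N u : in_L2 u -> cintegrable (iter N T u).
  by move=> uL; exact/in_L2_cintegrable/TL.
elim=> [|N IH] m; first by rewrite big_ord0 addr0.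
rewrite IH big_ord_recr /= (ae_eq_fourier m (cL N w wL) _ (step N)); last first.
  by apply: cintegrableD; [exact: (cL N.+1)|exact/in_L2_cintegrable/sL].
rewrite (fourierD m (cL N.+1 w wL) (in_L2_cintegrable (sL N))).
have ea := cL N.+1 e eL; have eb := cL N.+1 e' e'L.
rewrite (fourierD m (cintegrableZ a ea) (cintegrableZ b eb)).
rewrite (fourierZ a m ea) (fourierZ b m eb).
by rewrite -addrA [X in _ + X = _]addrC.
Qed.

End Iteration.

(** * Decay of the coefficients of the eigenfunction *)

Section MainEstimate.
Context {R : realType}.
Implicit Types (w : R -> R[i]) (j m : int).

Local Notation mu := (@lebesgue_measure R).

Lemma cmod_sum_le (N : nat) (z : nat -> R[i]) (x : nat -> R) :
    (forall k : nat, cmod (z k) <= x k) ->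
  cmod (\sum_(k < N) z k) <= \sum_(k < N) x k.
Proof.
move=> zx; elim: N => [|N IH]; first by rewrite !big_ord0 cmod0.
by rewrite !big_ord_recr; exact: le_trans (ler_cmodD _ _) (lerD IH (zx N)).
Qed.

Lemma sum_half (N : nat) : \sum_(k < N) 2^-1 ^+ k.+1 = 1 - 2^-1 ^+ N :> R.
Proof.
elim: N => [|N IH]; first by rewrite big_ord0 expr0 subrr.
by rewrite big_ord_recr /= IH exprS; field.
Qed.

Lemma le_of_geometric (x y W : R) :
  (forall N : nat, x <= W * 2^-1 ^+ N + y) -> x <= y.
Proof.
move=> h; have W0 : (fun N => geometric W 2^-1 N + y) @ \oo --> 0 + y.
  apply: cvgD; last exact: cvg_cst.
  by apply: cvg_geometric; rewrite ger0_norm ?invf_lt1 ?ltr1n.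
rewrite add0r in W0; apply: (cvgr_to_ge W0); exact: nearW.
Qed.

(** [resolvent] is a choice among the solutions in [H^s], with default [0]. *)
Lemma resolvent_dichotomy (s : R) (q : R -> R[i]) (n : nat) (lam : R[i])
    (g : R -> R[i]) :
  resolvent s q n lam g = (fun=> 0) \/
  (in_Hs s (resolvent s q n lam g) /\
   {ae mu, forall x : R, resolvent s q n lam g x -
                         Tn q n lam (resolvent s q n lam g) x = g x}).
Proof. by rewrite /resolvent; case: xgetP => [w -> ?|_]; [right|left]. Qed.

(** In the norm shifted by [- j] the mode [e_j] has size [1], whatever [j]. *)
Lemma iter_mode_coef_le (s : R) (T : (R -> R[i]) -> R -> R[i]) :
    iterates_halve s T ->
  forall (N : nat) j m, cmod (fourier (iter N T (cexp j)) m) <=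
    2^-1 ^+ N * bracket R (m - j) `^ (- s).
Proof.
move=> itT N j m; apply: coef_le_of_shifted_snorm.
have [_ /(_ (- j))] := itT N _ (cexp_in_Hs s j).
by rewrite shifted_snorm_cexp mule1.
Qed.

Lemma resolvent_coef_resonant (T : (R -> R[i]) -> R -> R[i]) (w : R -> R[i])
    (a b : R[i]) (n : nat) m : in_L2 w ->
    (forall u, in_L2 u -> fourier (T u) m = 0) ->
    fourier w m = fourier (iter 1 T w) m +
      \sum_(k < 1) (a * fourier (iter k.+1 T (cexp (- n%:Z))) m +
                    b * fourier (iter k.+1 T (cexp n%:Z)) m) ->
  fourier w m = 0.
Proof.
move=> wL T0 ->; rewrite big_ord1 /= !T0 //; try exact: in_L2_cexp.
by rewrite !mulr0 !addr0.
Qed.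

(** Each of the two modes contributes at most [1/2 + 1/4 + ... = 1] times
    [<|m| - n>^(-s)], because [|m - n|] and [|m + n|] are both at least
    [||m| - n|]; the remainder [T^N w] vanishes in the limit. *)
Lemma resolvent_coef_le (s : R) (T : (R -> R[i]) -> R -> R[i]) (w : R -> R[i])
    (a b : R[i]) (n : nat) : 0 < s ->
    iterates_halve s T ->
    in_Hs s w -> cmod a <= 1 -> cmod b <= 1 ->
    (forall (N : nat) m, fourier w m = fourier (iter N T w) m +
      \sum_(k < N) (a * fourier (iter k.+1 T (cexp (- n%:Z))) m +
                    b * fourier (iter k.+1 T (cexp n%:Z)) m)) ->
  forall m, cmod (fourier w m) <= 2 * bracket R (`|m| - n%:Z) `^ (- s).
Proof.
move=> s0 itT wH a1 b1 unroll m; set B := bracket R _ `^ _.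
have B0 : 0 <= B by exact: powR_ge0.
have mode N j c : `|j|%N = n -> cmod c <= 1 ->
    cmod (c * fourier (iter N T (cexp j)) m) <= 2^-1 ^+ N * B.
  move=> jn c1; rewrite cmodM -[leRHS]mul1r.
  apply: ler_pM => //; try exact: cmod_ge0.
  apply: (le_trans (iter_mode_coef_le itT N j m)).
  rewrite ler_wpM2l ?exprn_ge0 ?invr_ge0 //.
  by apply: ler_bracket_powRN; [exact: ltW|lia].
have [W wW] : exists W : R, shifted_snorm s 0 w = W%:E.
  have := wH.2; rewrite shifted_snorm0; have := snorm_ge0 s w.
  by case: (snorm s w) => // r _ _; exists r.
have W0 : 0 <= W by rewrite -lee_fin -wW shifted_snorm0 snorm_ge0.
apply: (@le_of_geometric _ _ W) => N.
rewrite (unroll N m); apply: (le_trans (ler_cmodD _ _)); apply: lerD.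
  have [_ /(_ 0)] := itT N w wH; rewrite wW -EFinM => /coef_le_of_shifted_snorm.
  move=> /(_ m) h; apply: (le_trans h).
  rewrite mulrC [W * _]mulrC ler_piMl ?mulr_ge0 ?exprn_ge0 ?invr_ge0 //.
  have -> : 1 = bracket R 0 `^ (- s) by rewrite bracket0 powR1.
  by apply: ler_bracket_powRN; [exact: ltW|rewrite absz0].
apply: (@le_trans _ _ (\sum_(k < N) (2^-1 ^+ k.+1 * B + 2^-1 ^+ k.+1 * B))).
  apply: (cmod_sum_le N
    (z := fun k => a * fourier (iter k.+1 T (cexp (- n%:Z))) m +
                   b * fourier (iter k.+1 T (cexp n%:Z)) m)
    (x := fun k => 2^-1 ^+ k.+1 * B + 2^-1 ^+ k.+1 * B)) => k.
  apply: (le_trans (ler_cmodD _ _)).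
  by apply: lerD; apply: mode; rewrite ?abszN.
rewrite big_split /= -mulr_suml sum_half.
have : 0 <= 2^-1 ^+ N * B by rewrite mulr_ge0 ?exprn_ge0 ?invr_ge0.
by lra.
Qed.

End MainEstimate.

Theorem theorem3p5 (R : realType) (s C : R) (n : nat) (q : R -> R[i])
  (s_gt0 : 0 < s) (n_ge1 : (1 <= n)%N)
  (q_Hs : in_Hs s q) (q_real : real_valued q)
  (C_gt0 : 0 < C) (C_bound : Tn_bound s C)
  (q_small : (snorm s q <= (n%:R / (2 * C))%:E)%E)
  (lam : R[i]) (lam_Dn : in_Dn s C q n lam)
  (lam_root : \det (Sn s q n lam) = 0)
  (U : 'cV[R[i]]_2) (U_neq0 : U != 0)
  (U_sol : Sn s q n lam *m U = 0)
  (U_normalized : forall i : 'I_2, cmod (U i 0) <= 1)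
  (m : int) :
  cmod (inner (f_fun s q n lam U) (cexp m)) <=
    2 * bracket R (`|m| - n%:Z) `^ (- s).
Proof.
have [qL _] := q_Hs.
have half := Tn_contraction n_ge1 q_Hs q_real C_gt0 C_bound q_small
  (in_Dn_Un C_gt0 q_small lam_Dn).
have itT := iter_Tn q_Hs half.
set a := U 0 0; set b := U 1 0.
have a1 : cmod a <= 1 by exact: U_normalized.
have b1 : cmod b <= 1 by exact: U_normalized.
have eL j : in_L2 (@cexp R j) by exact: in_L2_cexp.
have iu : cintegrable (u_fun n U).
  by apply: cintegrableD; apply: cintegrableZ; exact: cintegrable_cexp.
have uhat : fourier (u_fun n U) m = a * (- n%:Z == m)%:R + b * (n%:Z == m)%:R.
  rewrite /u_fun fourierD; try by apply: cintegrableZ; exact: cintegrable_cexp.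
  by rewrite !fourierZ ?fourier_cexp //; exact: cintegrable_cexp.
set B := bracket R _ `^ _.
have B0 : 0 <= B by exact: powR_ge0.
have Bres : `|m|%N = n -> B = 1.
  move=> mn; rewrite /B (_ : `|m| - n%:Z = 0) ?bracket0 ?powR1 //; lia.
have ule : `|m|%N = n -> cmod (fourier (u_fun n U) m) <= 1.
  move=> mn; rewrite uhat; have [->|->] : m = n%:Z \/ m = - n%:Z by lia.
    have /negPf -> : - n%:Z != n%:Z by apply/eqP; lia.
    by rewrite eqxx mulr1 mulr0 add0r.
  have /negPf -> : n%:Z != - n%:Z by apply/eqP; lia.
  by rewrite eqxx mulr1 mulr0 addr0.
have u0 : `|m|%N <> n -> fourier (u_fun n U) m = 0.
  move=> mn; rewrite uhat.
  have /negPf -> : - n%:Z != m by apply/eqP; lia.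
  have /negPf -> : n%:Z != m by apply/eqP; lia.
  by rewrite !mulr0 addr0.
have uL : in_L2 (u_fun n U) by apply: in_L2D; exact: in_L2Z.
have Tu x : Tn q n lam (u_fun n U) x =
    a * Tn q n lam (cexp (- n%:Z)) x + b * Tn q n lam (cexp n%:Z) x.
  rewrite /u_fun (TnD n lam qL (in_L2Z a (eL (- n%:Z))) (in_L2Z b (eL n%:Z))).
  by rewrite (TnZ n lam a qL (eL (- n%:Z))) (TnZ n lam b qL (eL n%:Z)).
rewrite /f_fun -/(fourier _ m).
case: (resolvent_dichotomy s q n lam (Tn q n lam (u_fun n U))) => [->|].
  (* The default value of the resolvent: the eigenfunction is [u_fun n U]. *)
  under [X in fourier X]eq_fun do rewrite addr0.
  have [mn|mn] := eqVneq `|m|%N n.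
    by rewrite (Bres mn); have := ule mn; lra.
  by rewrite u0 ?cmod0 ?mulr_ge0 //; apply/eqP.
move: (resolvent _ _ _ _ _) => w [wH weq]; have [wL _] := wH.
rewrite (fourierD m iu (in_L2_cintegrable wL)).
have weq' : {ae lebesgue_measure, forall x : R, w x = Tn q n lam w x +
    (a * Tn q n lam (cexp (- n%:Z)) x + b * Tn q n lam (cexp n%:Z) x)}.
  apply: (@filterS _ _ (ae_filter_ringOfSetsType lebesgue_measure)) weq.
  by move=> x /= h; rewrite -Tu -h addrC subrK.
have TL u : in_L2 u -> in_L2 (Tn q n lam u) by exact: Tn_in_L2.
have unroll := unroll_resolvent TL (fun u v => @ae_eq_Tn _ q n lam u v qL)
  (fun u v => @TnD _ q n lam u v qL) (fun c u => @TnZ _ q n lam c u qL)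
  wL (eL (- n%:Z)) (eL n%:Z) weq'.
(* For [|m| = n] only [u] contributes, for [|m| <> n] only [w] does. *)
have [mn|mn] := eqVneq `|m|%N n.
  have T0 u : in_L2 u -> fourier (Tn q n lam u) m = 0.
    by move=> vL; exact: fourier_Tn_resonant.
  rewrite (resolvent_coef_resonant wL T0 (unroll 1%N m)).
  by rewrite addr0 (Bres mn); have := ule mn; lra.
rewrite u0 ?add0r; last exact/eqP.
exact: (resolvent_coef_le s_gt0 itT wH a1 b1 unroll m).
Qed.
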